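(* The greedy strategy $\mathcal{S}_g$ is both a minimizing Shuffler strategy and a maximizing Shuffler strategy for the Guesser-Shuffler game. Moreover, $\mathcal{S}_g$ is the unique minimizing Shuffler strategy (where two Shuffler strategies $\mathcal{S},\mathcal{S}'$ are regarded as the same if $\mathcal{S}(d)$ and $\mathcal{S}'(d)$ have the same distribution for every nonzero $n$-vector $d$, for all $n$).
   Context: For an integer $n\ge 1$, an $n$-vector is a vector $d=(d_1,\ldots,d_n)$ of non-negative integers ($d_i$ is the number of cards of type $i$ left in the deck), and $[n]=\{1,\dots,n\}$. Let $\mathrm{supp}(d)=\{i: d_i>0\}$, and let $\delta_i$ be the $n$-vector with a 1 in position $i$ and 0's elsewhere. A Guesser strategy $\mathcal{G}$ is a function assigning to each nonzero $n$-vector $d$ (for all $n$) a random variable $\mathcal{G}(d)$ with support in $[n]$. A Shuffler strategy $\mathcal{S}$ is a function assigning to each nonzero $n$-vector $d$ (for all $n$) a random variable $\mathcal{S}(d)$ with support in $\mathrm{supp}(d)$. Strategies matter only through the distributions of these random variables. In the game, the players choose simultaneously: in each round the choices of the two players are independent of each other, and (given the current deck) of all earlier rounds. The score is defined recursively by $C(d,\mathcal{G},\mathcal{S})=0$ if $d=(0,\ldots,0)$, and otherwise $C(d,\mathcal{G},\mathcal{S})=1_{\mathcal{S}(d)=\mathcal{G}(d)}+C(d-\delta_{\mathcal{S}(d)},\mathcal{G},\mathcal{S})$. For integers $m,n\ge1$, $C_{m,n}(\mathcal{G},\mathcal{S})=C(d,\mathcal{G},\mathcal{S})$ where $d=(m,\ldots,m)$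 is the $n$-vector with all entries $m$ (this is the number of correct guesses in the Guesser-Shuffler game). A Shuffler strategy $\mathcal{S}$ is a minimizing Shuffler strategy if for all $m,n$ we have $\max_{\mathcal{G}}\mathbb{E}[C_{m,n}(\mathcal{G},\mathcal{S})]=\min_{\mathcal{S}'}\max_{\mathcal{G}}\mathbb{E}[C_{m,n}(\mathcal{G},\mathcal{S}')]$, and a maximizing Shuffler strategy if for all $m,n$ we have $\min_{\mathcal{G}}\mathbb{E}[C_{m,n}(\mathcal{G},\mathcal{S})]=\max_{\mathcal{S}'}\min_{\mathcal{G}}\mathbb{E}[C_{m,n}(\mathcal{G},\mathcal{S}')]$, where the maxima and minima range over all Guesser strategies $\mathcal{G}$ and Shuffler strategies $\mathcal{S}'$. The greedy strategy $\mathcal{S}_g$ is the Shuffler strategy with $\Pr[\mathcal{S}_g(d)=i]=|\mathrm{supp}(d)|^{-1}$ for all $i\in\mathrm{supp}(d)$. *)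

(* Defs.v *)
From mathcomp Require Import all_boot all_order all_algebra.
From mathcomp Require Import boolp classical_sets reals.

Set Implicit Arguments.
Unset Strict Implicit.
Unset Printing Implicit Defensive.

Import Order.TTheory GRing.Theory Num.Theory.
Local Open Scope ring_scope.

Definition deck (n : nat) := {ffun 'I_n -> nat}.

Definition empty_deck (n : nat) : deck n := [ffun=> 0%N].

Definition const_deck (m n : nat) : deck n := [ffun=> m].

Definition supp (n : nat) (d : deck n) : {set 'I_n} := [set i | (0 < d i)%N].

(* [d - delta_i]; the truncated subtraction is only relevant when [d i = 0],
   and a Shuffler draws such an [i] with probability 0. *)
Definition draw (n : nat) (d : deck n) (i : 'I_n) : deck n :=
  [ffun k => (d k - (k == i))%N].

Definition is_pmf (R : realType) (n : nat) (p : 'I_n -> R) : Prop :=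
  (forall i, 0 <= p i) /\ \sum_i p i = 1.

(* Strategies are given by the probability mass functions of the chosen types.
   The value at an empty deck is unconstrained and never used. *)
Record guesser (R : realType) := Guesser {
  guess_pr :> forall n : nat, deck n -> 'I_n -> R;
  guess_pmf : forall (n : nat) (d : deck n),
    d != empty_deck n -> is_pmf (guess_pr d) }.

Record shuffler (R : realType) := Shuffler {
  shuffle_pr :> forall n : nat, deck n -> 'I_n -> R;
  shuffle_pmf : forall (n : nat) (d : deck n),
    d != empty_deck n -> is_pmf (shuffle_pr d);
  shuffle_supp : forall (n : nat) (d : deck n),
    d != empty_deck n -> forall i, i \notin supp d -> shuffle_pr d i = 0 }.

Definition same_shuffler (R : realType) (S S' : shuffler R) : Prop :=
  forall (n : nat) (d : deck n), d != empty_deck n ->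
    forall i : 'I_n, S n d i = S' n d i.

(* A play lists the pairs (guessed type, drawn type), round by round. *)
Fixpoint play_pr (R : realType) (G : guesser R) (S : shuffler R) (n : nat)
    (d : deck n) (w : seq ('I_n * 'I_n)) : R :=
  if w is (g, s) :: w' then G n d g * S n d s * play_pr G S (draw d s) w'
  else 1.

Fixpoint score (n : nat) (w : seq ('I_n * 'I_n)) : nat :=
  if w is (g, s) :: w' then ((s == g) + score w')%N else 0%N.

(* The deck empties after exactly [\sum_i d i] rounds, so the sample space of
   the game from [d] is the finite set of plays of that length. *)
Definition expected_score (R : realType) (n : nat) (d : deck n)
    (G : guesser R) (S : shuffler R) : R :=
  \sum_(w : (\sum_i d i)%N.-tuple ('I_n * 'I_n)%type)
    play_pr G S d w * (score w)%:R.

Definition expected_C (R : realType) (m n : nat) (G : guesser R)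
    (S : shuffler R) : R :=
  expected_score (const_deck m n) G S.

Definition is_max (R : realType) (A : set R) (v : R) : Prop :=
  A v /\ ubound A v.

Definition is_min (R : realType) (A : set R) (v : R) : Prop :=
  A v /\ lbound A v.

(* [V S'] is [max_G E[C_{m,n}(G, S')]] (below, the min over G); it is determined by its first property,
   which also asserts that the extrema are attained. *)
Definition minimizing (R : realType) (S : shuffler R) : Prop :=
  forall m n : nat, (0 < m)%N -> (0 < n)%N ->
  exists V : shuffler R -> R,
    (forall S', is_max (range (fun G => expected_C m n G S')) (V S'))
    /\ is_min (range V) (V S).

Definition maximizing (R : realType) (S : shuffler R) : Prop :=
  forall m n : nat, (0 < m)%N -> (0 < n)%N ->
  exists V : shuffler R -> R,
    (forall S', is_min (range (fun G => expected_C m n G S')) (V S'))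
    /\ is_max (range V) (V S).

Definition greedy_pr (R : realType) (n : nat) (d : deck n) (i : 'I_n) : R :=
  if i \in supp d then #|supp d|%:R^-1 else 0.

Lemma greedy_pmf (R : realType) (n : nat) (d : deck n) :
  d != empty_deck n -> is_pmf (greedy_pr R d).
Proof.
move=> dn0; split=> [i|]; first by rewrite /greedy_pr; case: ifP; rewrite ?invr_ge0 ?ler0n.
have sn0 : supp d != finset.set0.
  apply: contra dn0 => /eqP s0; apply/eqP/ffunP=> i; rewrite ffunE.
  by have := finset.in_set0 i; rewrite -s0 inE lt0n => /negbFE/eqP.
rewrite -(big_mkcond (mem (supp d))) /= sumr_const -[_ *+ _]mulr_natl divff //.
by rewrite pnatr_eq0 cards_eq0.
Qed.

Lemma greedy_supp (R : realType) (n : nat) (d : deck n) :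
  d != empty_deck n -> forall i, i \notin supp d -> greedy_pr R d i = 0.
Proof. by move=> _ i /negbTE iS; rewrite /greedy_pr iS. Qed.

Definition greedy (R : realType) : shuffler R :=
  Shuffler (@greedy_pmf R) (@greedy_supp R).

(* Main.v *)
(* For f the value of the greedy Shuffler against a best Guesser, the greedy
   recursion says exactly that the drops L_i = f(d) - f(d - delta_i) sum to 1.
   They are nonnegative (positive on the support, by induction on the deck), so
   playing p in one round and greedy afterwards is worth
   max p + f(d) - sum_i p_i L_i >= f(d), with equality only for p uniform on the
   support.  For a worst Guesser the drops are nonnegative and sum to 1 or 0
   according to whether all types are left; min p vanishes in the latter case,
   so min p - sum_i p_i L_i <= 0.  Uniqueness: every deck is reached from a
   constant one by draws, and equality of values propagates along draws. *)
Require Import Defs.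
From mathcomp Require Import all_boot all_order all_algebra.
From mathcomp Require Import reals.
From mathcomp Require Import classical_sets.
From mathcomp Require Import ring.

Set Implicit Arguments.
Unset Strict Implicit.
Unset Printing Implicit Defensive.

Import Order.TTheory GRing.Theory Num.Theory.
Local Open Scope ring_scope.

(** * Decks and inductions along draws *)

Section Decks.
Variable n : nat.
Implicit Types (d : deck n) (i j : 'I_n).

Lemma suppE d i : (i \in supp d) = (0 < d i)%N.
Proof. by rewrite inE. Qed.

Lemma deck_neq0P d : reflect (exists i, (0 < d i)%N) (d != empty_deck n).
Proof.
apply: (iffP idP) => [d0|[i di]]; last first.
  by apply: contraTneq di => ->; rewrite ffunE.
apply/existsP; apply: contraNT d0; rewrite negb_exists => /forallP d0.
by apply/eqP/ffunP => i; rewrite ffunE; apply/eqP; rewrite -leqn0 leqNgt.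
Qed.

Lemma drawE d i j : draw d i j = (d j - (j == i))%N.
Proof. by rewrite ffunE. Qed.

Lemma draw_id d i : (0 < d i)%N = false -> draw d i = d.
Proof.
move=> di; apply/ffunP => j; rewrite drawE; case: eqP => [->|_]; last by rewrite subn0.
by apply/eqP; move: di; case: (d i).
Qed.

Lemma drawC d i j : draw (draw d i) j = draw (draw d j) i.
Proof. by apply/ffunP => k; rewrite !drawE subnAC. Qed.

Lemma sum_draw d i : (0 < d i)%N -> (\sum_j d j = (\sum_j draw d i j).+1)%N.
Proof.
move=> di; rewrite (bigD1 i) //= [in RHS](bigD1 i) //= drawE eqxx -addSn.
rewrite subn1 prednK //; congr addn.
by apply: eq_bigr => j /negbTE ji; rewrite drawE ji subn0.
Qed.

Lemma sum_deck_gt0 d : d != empty_deck n -> (0 < \sum_j d j)%N.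
Proof. by move=> /deck_neq0P[i di]; rewrite (sum_draw di). Qed.

Lemma draw_ind (P : deck n -> Prop) :
  (forall d, (forall i, (0 < d i)%N -> P (draw d i)) -> P d) -> forall d, P d.
Proof.
move=> IH d; have [k] := ubnP (\sum_j d j)%N; elim: k d => // k IHk d.
rewrite ltnS => dk; apply: IH => i di; apply: IHk.
by rewrite -(sum_draw di).
Qed.

(** Induction on the number of cards missing from the constant deck: a type [i] with [d i < m] makes
    [d] a draw from the deck [e] with one more card of type [i]. *)
Lemma le_const_deck_ind (m : nat) (P : deck n -> Prop) :
    P (const_deck m n) ->
    (forall d i, (0 < d i)%N -> P d -> P (draw d i)) ->
  forall d, (forall i, d i <= m)%N -> P d.
Proof.
move=> Pm Pdraw d; have [k] := ubnP (\sum_j (m - d j))%N.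
elim: k d => // k IHk d; rewrite ltnS => dk dm.
have [/forallP dE|] := boolP [forall i, d i == m].
  suff -> : d = const_deck m n by [].
  by apply/ffunP => i; rewrite ffunE; apply/eqP.
rewrite negb_forall => /existsP[i di].
have {}di : (d i < m)%N by rewrite ltn_neqAle di dm.
pose e : deck n := [ffun j => (d j + (j == i))%N].
have -> : d = draw e i by apply/ffunP => j; rewrite drawE ffunE addnK.
apply: Pdraw; first by rewrite ffunE eqxx addn1.
apply: IHk => [|j]; last by rewrite ffunE; case: eqP => [->|]; rewrite ?addn1 ?addn0.
apply: leq_trans dk; rewrite [X in (X < _)%N](bigD1 i) // [leqRHS](bigD1 i) //=.
rewrite ffunE eqxx addn1 subnS -addSn prednK ?subn_gt0// leq_add2l.
by apply: leq_sum => j /negbTE ji; rewrite ffunE ji addn0.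
Qed.

End Decks.

(** * Splitting off the first round: the recursion for the expected score *)

Lemma big_cons_tuple (R : nmodType) (T1 T2 : finType) (k : nat)
    (F : seq (T1 * T2) -> R) :
  \sum_(w : k.+1.-tuple (T1 * T2)%type) F w
    = \sum_(x : T1) \sum_(y : T2) \sum_(w : k.-tuple (T1 * T2)%type) F ((x, y) :: w).
Proof.
rewrite pair_bigA pair_bigA /=.
rewrite (reindex (fun p : (T1 * T2) * k.-tuple (T1 * T2)%type =>
  cons_tuple p.1 p.2)) /=; first by apply: eq_bigr => -[[x y] w].
exists (fun w : k.+1.-tuple _ => (thead w, behead_tuple w)) => [[x w]|w] _ /=.
  by congr pair; apply: val_inj.
by rewrite [RHS]tuple_eta; apply: val_inj.
Qed.

Section Recursion.
Variables (R : realType) (n : nat) (G : guesser R) (S : shuffler R).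
Implicit Types (d : deck n).

Lemma eq_sum_shuffle d (F F' : 'I_n -> R) : d != empty_deck n ->
    (forall i, (0 < d i)%N -> F i = F' i) ->
  \sum_i S n d i * F i = \sum_i S n d i * F' i.
Proof.
move=> d0 FE; apply: eq_bigr => i _.
have [di|di] := boolP (0 < d i)%N; first by rewrite FE.
by rewrite (shuffle_supp S d0) ?suppE // !mul0r.
Qed.

Lemma sum_play_pr (k : nat) d : (\sum_i d i)%N = k ->
  \sum_(w : k.-tuple ('I_n * 'I_n)%type) play_pr G S d w = 1.
Proof.
elim: k d => [|k IHk] d dk.
  rewrite (bigD1 [tuple]) //= big1 ?addr0 // => w.
  by rewrite tuple0.
have d0 : d != empty_deck n.
  by apply: contra_eqN dk => /eqP->; rewrite big1 // => i _; rewrite ffunE.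
have [_ G1] := guess_pmf G d0; have [_ S1] := shuffle_pmf S d0.
rewrite (big_cons_tuple _ (play_pr G S d)) /=.
under eq_bigr do under eq_bigr do rewrite -mulr_sumr -mulrA.
rewrite -[RHS]G1; apply: eq_bigr => g _; rewrite -mulr_sumr -[RHS]mulr1; congr (_ * _).
rewrite -[RHS]S1; under [RHS]eq_bigr do rewrite -[S _ _ _]mulr1.
apply: eq_sum_shuffle => // i di; apply: IHk.
by apply: succn_inj; rewrite -dk; symmetry; apply: sum_draw.
Qed.

Lemma expected_score0 : expected_score (empty_deck n) G S = 0.
Proof.
rewrite /expected_score big1 // => -[w /=]; rewrite big1 => [|i _]; last by rewrite ffunE.
by case: w => // _ _; rewrite mulr0.
Qed.

(** Linearity of expectation: in the first-round term the later rounds sum out to 1, in the other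
    term the first guess does. *)
Lemma expected_score_rec d : d != empty_deck n ->
  expected_score d G S = \sum_s S n d s * G n d s
                         + \sum_s S n d s * expected_score (draw d s) G S.
Proof.
move=> d0; have [_ G1] := guess_pmf G d0.
rewrite -big_split /=; under [RHS]eq_bigr do rewrite -mulrDr.
rewrite /expected_score.
case dk: (\sum_i d i)%N => [|k]; first by have := sum_deck_gt0 d0; rewrite dk.
rewrite (big_cons_tuple _ (fun w => play_pr G S d w * (score w)%:R)) /=.
rewrite exchange_big /=.
under eq_bigr => s _.
  have -> : \sum_g \sum_(w : k.-tuple ('I_n * 'I_n)%type)
       G n d g * S n d s * play_pr G S (draw d s) w * ((s == g) + score w)%:R
    = S n d s * \sum_g \sum_(w : k.-tuple ('I_n * 'I_n)%type)
       G n d g * (play_pr G S (draw d s) w * ((s == g) + score w)%:R).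
    rewrite mulr_sumr; apply: eq_bigr => g _; rewrite mulr_sumr.
    by apply: eq_bigr => w _; rewrite !mulrA [S n d s * _]mulrC.
  over.
apply: eq_sum_shuffle => // s ds.
have sk : (\sum_i draw d s i)%N = k.
  by apply: succn_inj; rewrite -dk; symmetry; apply: sum_draw.
rewrite sk; set E := \sum_(w : k.-tuple _) _.
under eq_bigr => g _.
  rewrite -mulr_sumr; under eq_bigr do rewrite natrD mulrDr.
  rewrite big_split /= -mulr_suml sum_play_pr // mul1r -/E mulrDr.
  over.
rewrite big_split /= -mulr_suml G1 mul1r; congr (_ + _).
rewrite (bigD1 s) //= eqxx mulr1 big1 ?addr0 // => g /negbTE gs.
by rewrite eq_sym gs mulr0.
Qed.

End Recursion.

(** * Best and worst responses of the Guesser *)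

Section ExtremalGuesser.
Variable R : realType.

Section ArgMax.
Variable f : forall n : nat, deck n -> 'I_n -> R.

(** Point mass at one maximiser of [f d], selected by [pick]. *)
Definition argmax_pr (n : nat) (d : deck n) (i : 'I_n) : R :=
  (Some i == [pick j | [forall k, f d k <= f d j]])%:R.

Lemma argmax_prP (n : nat) (d : deck n) : d != empty_deck n ->
  exists2 i, forall j, f d j <= f d i & forall F : 'I_n -> R,
    \sum_j F j * argmax_pr d j = F i.
Proof.
move=> /deck_neq0P[i0 _]; rewrite /argmax_pr; case: pickP => [i /forallP fi|none].
  exists i => // F; rewrite (bigD1 i) //= eqxx mulr1 big1 ?addr0 // => j /negbTE ji.
  by rewrite (inj_eq Some_inj) ji mulr0.
have [i _ fi] := @arg_maxP _ _ _ i0 xpredT (f d) isT.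
by have /negP[] := negbT (none i); apply/forallP => j; apply: fi.
Qed.

Lemma argmax_pmf (n : nat) (d : deck n) : d != empty_deck n -> is_pmf (argmax_pr d).
Proof.
move=> /argmax_prP[i _ sumE]; split=> [j|]; first exact: ler0n.
by rewrite -[RHS](sumE (fun=> 1)); apply: eq_bigr => j _; rewrite mul1r.
Qed.

Definition argmax_guesser : guesser R := Guesser argmax_pmf.

End ArgMax.

Variables (n : nat) (S : shuffler R).
Implicit Types (d : deck n) (G : guesser R).

Definition best_guesser := argmax_guesser S.
Definition worst_guesser := argmax_guesser (fun k (e : deck k) i => - S k e i).

Lemma best_guesserP d : d != empty_deck n ->
  exists2 i, forall j, S n d j <= S n d i & \sum_s S n d s * best_guesser n d s = S n d i.
Proof. by move=> /(argmax_prP S)[i Si sumE]; exists i => //; apply: sumE. Qed.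

Lemma worst_guesserP d : d != empty_deck n ->
  exists2 i, forall j, S n d i <= S n d j & \sum_s S n d s * worst_guesser n d s = S n d i.
Proof.
move=> /(argmax_prP (fun k (e : deck k) i => - S k e i))[i Si sumE].
by exists i => [j|]; [rewrite -lerN2; apply: Si | apply: sumE].
Qed.

Lemma shuffle_ge0 d i : d != empty_deck n -> 0 <= S n d i.
Proof. by move=> /(shuffle_pmf S)[]. Qed.

Lemma sum_shuffle d : d != empty_deck n -> \sum_i S n d i = 1.
Proof. by move=> /(shuffle_pmf S)[]. Qed.

(** Guesses do not influence the deck, so domination in every single round gives domination of the
    total score. *)
Lemma le_expected_score G G' d :
    (forall d, d != empty_deck n ->
       \sum_s S n d s * G n d s <= \sum_s S n d s * G' n d s) ->
  expected_score d G S <= expected_score d G' S.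
Proof.
move=> le_GG'; elim/draw_ind: d => d IH.
have [->|d0] := eqVneq d (empty_deck n); first by rewrite !expected_score0.
rewrite !expected_score_rec //; apply: lerD; first exact: le_GG'.
apply: ler_sum => i _; have [di|di] := boolP (0 < d i)%N.
  by rewrite ler_wpM2l ?shuffle_ge0 ?IH.
by rewrite (shuffle_supp S d0) ?suppE // !mul0r.
Qed.

(** In each round the chance of a match is an average of the [S n d s] with weights from [G], hence
    at most their maximum. *)
Lemma best_guesser_max G d : expected_score d G S <= expected_score d best_guesser S.
Proof.
apply: le_expected_score => {}d d0; have [i Si ->] := best_guesserP d0.
have [G0 G1] := guess_pmf G d0; rewrite -[leRHS]mulr1 -G1 mulr_sumr.
by apply: ler_sum => s _; rewrite ler_wpM2r.
Qed.

Lemma worst_guesser_min G d : expected_score d worst_guesser S <= expected_score d G S.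
Proof.
apply: le_expected_score => {}d d0; have [i Si ->] := worst_guesserP d0.
have [G0 G1] := guess_pmf G d0; rewrite -[leLHS]mulr1 -G1 mulr_sumr.
by apply: ler_sum => s _; rewrite ler_wpM2r.
Qed.

End ExtremalGuesser.

(** * Monotonicity of a function of decks, deduced from its total drop *)

Section Potential.
Variables (R : realType) (n : nat) (f : deck n -> R).
Implicit Types (d : deck n).

(** Exhausted types contribute 0, since [draw d i = d] for them. *)
Definition total_drop d : R := \sum_i (f d - f (draw d i)).

(** Since draws commute, the mixed second difference of [f] in [i] and [l] is symmetric; summing it
    over [l] expresses the drop at [d] through total drops and drops at smaller decks, ready for
    induction. *)
Lemma total_drop_draw d i :
  (f d - f (draw d i)) *+ #|supp d| =
  total_drop d - total_drop (draw d i)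
  + \sum_(l in supp d) (f (draw d l) - f (draw (draw d l) i)).
Proof.
rewrite -sumr_const; apply/eqP; rewrite -subr_eq -sumrB /total_drop -sumrB; apply/eqP.
rewrite [LHS]big_mkcond; apply: eq_bigr => l _; rewrite suppE (drawC d i).
case: ifP => [_|dl]; last by rewrite (draw_id dl) !subrr.
by ring.
Qed.

Hypothesis drop_le : forall d i, total_drop (draw d i) <= total_drop d.

Lemma potential_le d i : f (draw d i) <= f d.
Proof.
elim/draw_ind: d => d IH.
have [di|/negbTE di] := boolP (0 < d i)%N; last by rewrite draw_id.
rewrite -subr_ge0 -(@pmulrn_lge0 _ _ #|supp d|); last first.
  by apply/card_gt0P; exists i; rewrite suppE.
rewrite total_drop_draw addr_ge0 ?subr_ge0 // sumr_ge0 // => l.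
by rewrite suppE subr_ge0 => /IH.
Qed.

Hypothesis drop_lt : forall d i, (0 < d i)%N -> draw d i = empty_deck n ->
  total_drop (draw d i) < total_drop d.

(** Strictness comes from [drop_lt] if [i] is the last card, and otherwise from one summand of
    [total_drop_draw] by induction. *)
Lemma potential_lt d i : (0 < d i)%N -> f (draw d i) < f d.
Proof.
elim/draw_ind: d => d IH di.
rewrite -subr_gt0 -(@pmulrn_lgt0 _ _ #|supp d|); last first.
  by apply/card_gt0P; exists i; rewrite suppE.
have ge0 l : 0 <= f (draw d l) - f (draw (draw d l) i) by rewrite subr_ge0 potential_le.
rewrite total_drop_draw; have [d'0|] := eqVneq (draw d i) (empty_deck n).
  by rewrite ltr_wpDr ?subr_gt0 ?drop_lt // sumr_ge0.
(* Taking [l] from the deck left after [i] ensures that [i] can still be drawn after [l], even when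
   [l = i]. *)
move=> /deck_neq0P[l]; rewrite drawE => dil.
have dl : (0 < d l)%N by apply: leq_trans dil (leq_subr _ _).
rewrite ltr_wpDl ?subr_ge0 // (bigD1 l) ?suppE //= ltr_wpDr ?sumr_ge0 //.
rewrite subr_gt0 IH // drawE eq_sym.
by move: dil; case: eqP => [->|]; rewrite ?subn0.
Qed.

End Potential.

(** * The greedy Shuffler against its extremal Guessers, and comparison with other Shufflers *)

Section Greedy.
Variables (R : realType) (n : nat).
Implicit Types (d : deck n) (G : guesser R) (S : shuffler R).

Lemma total_drop_empty (f : deck n -> R) : total_drop f (empty_deck n) = 0.
Proof. by rewrite /total_drop big1 // => i _; rewrite draw_id ?subrr // ffunE. Qed.

Lemma card_supp_gt0 d : d != empty_deck n -> (0 < #|supp d|)%N.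
Proof. by move=> /deck_neq0P[i di]; apply/card_gt0P; exists i; rewrite suppE. Qed.

(** By the recursion, the chance of a match is the mean drop under the greedy distribution, which is
    uniform on the support. *)
Lemma greedy_total_drop G d : d != empty_deck n ->
  total_drop (fun d => expected_score d G (greedy R)) d
  = #|supp d|%:R * \sum_s greedy R n d s * G n d s.
Proof.
move=> d0; rewrite /total_drop; set g := fun d => expected_score d G (greedy R).
have -> : \sum_s greedy R n d s * G n d s
    = \sum_s greedy R n d s * (g d - g (draw d s)).
  under [RHS]eq_bigr do rewrite mulrBr.
  rewrite sumrB -mulr_suml sum_shuffle // mul1r.
  by rewrite [in RHS]/g expected_score_rec // addrK.
rewrite mulr_sumr; apply: eq_bigr => i _; rewrite /= /greedy_pr suppE.
case: ifP => [_|/draw_id->]; last by rewrite subrr !mulr0.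
by rewrite mulrA divff ?mul1r // pnatr_eq0 -lt0n card_supp_gt0.
Qed.

Let g d : R := expected_score d (best_guesser (greedy R)) (greedy R).
Let h d : R := expected_score d (worst_guesser (greedy R)) (greedy R).

Lemma best_greedy_total_drop d : total_drop g d = (d != empty_deck n)%:R.
Proof.
have [->|d0] := eqVneq; first by rewrite total_drop_empty.
rewrite greedy_total_drop //; have [i Si ->] := best_guesserP (greedy R) d0.
(* A most likely type is in the support: an exhausted one has probability 0, less than that of any
   type left. *)
suff di : i \in supp d.
  by rewrite /= /greedy_pr di divff // pnatr_eq0 -lt0n card_supp_gt0.
have /deck_neq0P[j dj] := d0; apply: contraLR (Si j) => iS.
by rewrite /= /greedy_pr (negbTE iS) suppE dj -ltNge invr_gt0 ltr0n card_supp_gt0.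
Qed.

Lemma worst_greedy_total_drop d : d != empty_deck n ->
  total_drop h d = [forall i, i \in supp d]%:R.
Proof.
move=> d0.
rewrite greedy_total_drop //; have [i Si ->] := worst_guesserP (greedy R) d0.
case: (boolP [forall _, _]) => [/forallP full|].
  by rewrite /= /greedy_pr full divff // pnatr_eq0 -lt0n card_supp_gt0.
rewrite negb_forall => /existsP[j jS]; suff -> : greedy R n d i = 0 by rewrite mulr0.
apply/eqP; rewrite eq_le shuffle_ge0 // andbT (le_trans (Si j)) //.
by rewrite /= /greedy_pr (negbTE jS).
Qed.

(** The total drop of [g] never increases along draws and falls from 1 to 0 with the last card. *)
Lemma best_greedy_draw_lt d i : (0 < d i)%N -> g (draw d i) < g d.
Proof.
apply: potential_lt => {d i}[d i|d i di d'0].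
  rewrite !best_greedy_total_drop.
  have [_|] := eqVneq (draw d i) (empty_deck n); first exact: ler0n.
  move=> /deck_neq0P[j]; rewrite drawE => dj.
  suff -> : d != empty_deck n by []; apply/deck_neq0P.
  by exists j; apply: leq_trans dj (leq_subr _ _).
rewrite d'0 !best_greedy_total_drop eqxx; suff -> : d != empty_deck n by [].
by apply/deck_neq0P; exists i.
Qed.

Lemma best_greedy_draw_le d i : g (draw d i) <= g d.
Proof.
have [di|/negbTE di] := boolP (0 < d i)%N; last by rewrite draw_id.
exact/ltW/best_greedy_draw_lt.
Qed.

Lemma worst_greedy_draw_le d i : h (draw d i) <= h d.
Proof.
apply: potential_le => {}d {}i.
have [->|d0] := eqVneq d (empty_deck n); first by rewrite draw_id // ffunE.
have [->|d'0] := eqVneq (draw d i) (empty_deck n).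
  by rewrite total_drop_empty worst_greedy_total_drop // ler0n.
rewrite !worst_greedy_total_drop //.
case: (boolP [forall j, j \in supp (draw d i)]) => [/forallP full|_]; last exact: ler0n.
suff -> : [forall j, j \in supp d] by []; apply/forallP => j; move: (full j); rewrite !suppE drawE => dj.
exact: leq_trans dj (leq_subr _ _).
Qed.

(** Splits the excess over [f] so that signs can be read off: the middle sum is controlled when [c]
    is the largest or smallest value of [S n d] and [f] decreases along draws, the last sum by
    induction. *)
Lemma expected_score_drop (f : deck n -> R) G S (c : R) d : d != empty_deck n ->
    \sum_s S n d s * G n d s = c ->
  expected_score d G S - f d = c * (1 - total_drop f d)
    + \sum_s (c - S n d s) * (f d - f (draw d s))
    + \sum_s S n d s * (expected_score (draw d s) G S - f (draw d s)).
Proof.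
move=> d0 cE; rewrite expected_score_rec // cE.
have fE : f d = \sum_s S n d s * f d by rewrite -mulr_suml sum_shuffle // mul1r.
rewrite mulrBr mulr1 /total_drop mulr_sumr [X in _ - X]fE -!addrA; congr (_ + _).
by rewrite -!sumrN -!big_split /=; apply: eq_bigr => s _; ring.
Qed.

Lemma best_greedy_min S d : g d <= expected_score d (best_guesser S) S.
Proof.
elim/draw_ind: d => d IH.
have [->|d0] := eqVneq d (empty_deck n); first by rewrite /g !expected_score0.
have [i Si /(expected_score_drop g d0) dropE] := best_guesserP S d0.
rewrite -subr_ge0 dropE best_greedy_total_drop d0 subrr mulr0 add0r addr_ge0 //.
  by apply: sumr_ge0 => s _; rewrite mulr_ge0 ?subr_ge0 ?Si ?best_greedy_draw_le.
apply: sumr_ge0 => s _; have [ds|ds] := boolP (0 < d s)%N.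
  by rewrite mulr_ge0 ?shuffle_ge0 ?subr_ge0 ?IH.
by rewrite (shuffle_supp S d0) ?suppE // mul0r.
Qed.

(** Equality makes every nonnegative term of [expected_score_drop] vanish, both now and in the
    future. *)
Lemma best_greedy_eq S d : d != empty_deck n ->
    expected_score d (best_guesser S) S <= g d ->
  (forall i, S n d i = greedy R n d i) /\
  (forall i, (0 < d i)%N -> expected_score (draw d i) (best_guesser S) S <= g (draw d i)).
Proof.
move=> d0; have [m Sm /(expected_score_drop g d0) dropE] := best_guesserP S d0.
rewrite -subr_le0 dropE best_greedy_total_drop d0 subrr mulr0 add0r.
set A := (X in X + _); set B := (X in _ + X) => AB.
have A0 s : 0 <= (S n d m - S n d s) * (g d - g (draw d s)).
  by rewrite mulr_ge0 ?subr_ge0 ?Sm ?best_greedy_draw_le.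
have B0 s : 0 <= S n d s * (expected_score (draw d s) (best_guesser S) S - g (draw d s)).
  by rewrite mulr_ge0 ?shuffle_ge0 ?subr_ge0 ?best_greedy_min.
have /andP[/eqP A_eq0 /eqP B_eq0] : (A == 0) && (B == 0).
  by rewrite -paddr_eq0 ?sumr_ge0 // eq_le AB addr_ge0 ?sumr_ge0.
(* The strictly positive drop can be cancelled, so [S] attains its maximum at every type left. *)
have SE s : (0 < d s)%N -> S n d s = S n d m.
  move=> ds; have /eqP := psumr_eq0P (fun j _ => A0 j) A_eq0 (i := s) isT.
  by rewrite mulf_eq0 !subr_eq0 (gt_eqF (best_greedy_draw_lt ds)) orbF => /eqP.
have Sm1 : S n d m *+ #|supp d| = 1.
  rewrite -(sum_shuffle S d0) -sumr_const big_mkcond; apply: eq_bigr => s _.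
  by case: ifPn => [|/(shuffle_supp S d0)->//]; rewrite suppE => /SE.
have k0 : #|supp d|%:R != 0 :> R by rewrite pnatr_eq0 -lt0n card_supp_gt0.
have {Sm1} SmE : S n d m = #|supp d|%:R^-1.
  by apply: (mulIf k0); rewrite mulVf // mulr_natr.
split=> [s|s ds]; rewrite /= /greedy_pr.
  by case: ifPn => [|/(shuffle_supp S d0)//]; rewrite suppE -SmE; exact: SE.
(* [S] gives [s] positive probability, so the excess after drawing [s] must be 0. *)
have /eqP := psumr_eq0P (fun j _ => B0 j) B_eq0 (i := s) isT.
by rewrite SE // SmE mulf_eq0 invr_eq0 (negbTE k0) subr_eq0 => /eqP->.
Qed.

Lemma worst_greedy_max S d : expected_score d (worst_guesser S) S <= h d.
Proof.
elim/draw_ind: d => d IH.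
have [->|d0] := eqVneq d (empty_deck n); first by rewrite /h !expected_score0.
have [i Si /(expected_score_drop h d0) dropE] := worst_guesserP S d0.
rewrite -subr_le0 dropE -oppr_ge0 !opprD !addr_ge0 //; last first.
- rewrite -sumrN; apply: sumr_ge0 => s _; rewrite -mulrN opprB.
  have [ds|ds] := boolP (0 < d s)%N; first by rewrite mulr_ge0 ?shuffle_ge0 ?subr_ge0 ?IH.
  by rewrite (shuffle_supp S d0) ?suppE // mul0r.
- rewrite -sumrN; apply: sumr_ge0 => s _; rewrite -mulNr opprB.
  by rewrite mulr_ge0 ?subr_ge0 ?Si ?worst_greedy_draw_le.
(* With all types left the factor [1 - total_drop] is 0; otherwise the minimum of [S n d] is at most
   0, its value at an exhausted type. *)
rewrite worst_greedy_total_drop //; case: (boolP [forall _, _]) => [_|].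
  by rewrite subrr mulr0 oppr0.
rewrite negb_forall => /existsP[j jS]; rewrite subr0 mulr1 oppr_ge0.
by rewrite (le_trans (Si j)) ?(shuffle_supp S d0).
Qed.

End Greedy.

(** * Attained extrema and the conclusion *)

Lemma best_guesser_is_max (R : realType) (m n : nat) (S : shuffler R) :
  is_max (range (fun G => expected_C m n G S)) (expected_C m n (best_guesser S) S).
Proof.
by split=> [|_ [G _ <-]]; [exists (best_guesser S) | exact: best_guesser_max].
Qed.

Lemma worst_guesser_is_min (R : realType) (m n : nat) (S : shuffler R) :
  is_min (range (fun G => expected_C m n G S)) (expected_C m n (worst_guesser S) S).
Proof.
by split=> [|_ [G _ <-]]; [exists (worst_guesser S) | exact: worst_guesser_min].
Qed.

Lemma is_max_unique (R : realType) (A : set R) (v w : R) :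
  is_max A v -> is_max A w -> v = w.
Proof. by move=> [Av vA] [Aw wA]; apply: le_anti; rewrite wA ?vA. Qed.

Theorem theorem1p3 (R : realType) :
  minimizing (greedy R) /\ maximizing (greedy R) /\
  (forall S : shuffler R, minimizing S -> same_shuffler S (greedy R)).
Proof.
split=> [m n _ _|].
  exists (fun S => expected_C m n (best_guesser S) S).
  split=> [S|]; first exact: best_guesser_is_max.
  by split=> [|_ [S _ <-]]; [exists (greedy R) | exact: best_greedy_min].
split=> [m n _ _|S Smin n d d0].
  exists (fun S => expected_C m n (worst_guesser S) S).
  split=> [S|]; first exact: worst_guesser_is_min.
  by split=> [|_ [S _ <-]]; [exists (greedy R) | exact: worst_greedy_max].
(* Minimality speaks only of constant decks, so [d] is placed below one. *)
have [m dm] : exists m, forall i, (d i <= m)%N.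
  by exists (\max_i d i)%N => i; apply: leq_bigmax.
have /deck_neq0P[i0 di0] := d0.
have m_gt0 : (0 < m)%N by apply: leq_trans di0 (dm i0).
have n_gt0 : (0 < n)%N by apply: leq_ltn_trans (ltn_ord i0).
have [V [Vmax [_ Vmin]]] := Smin m n m_gt0 n_gt0.
have VE S' : V S' = expected_C m n (best_guesser S') S'.
  exact: is_max_unique (Vmax S') (best_guesser_is_max m n S').
suff le_greedy : expected_score d (best_guesser S) S
    <= expected_score d (best_guesser (greedy R)) (greedy R).
  by have [] := best_greedy_eq d0 le_greedy.
clear d0 i0 di0.
(* The base case is minimality of [S] compared with [greedy]; each draw preserves the inequality by
   [best_greedy_eq]. *)
elim/le_const_deck_ind: d / dm => [|e i ei le_e].
  by move: (Vmin (V (greedy R))); rewrite !VE; apply; exists (greedy R).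
have e0 : e != empty_deck n by apply/deck_neq0P; exists i.
by have [_ ->] := best_greedy_eq e0 le_e.
Qed.
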